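(* Let $\alpha\in[0,1)$ and let $G$ be a connected graph of order $n\ge 5$ with maximum degree $\Delta$, where $2\le\Delta\le n-1$. Then $\mu_{\alpha}(G)\le\mu_{\alpha}(B_{n,\Delta})$, with equality if and only if $G\cong B_{n,\Delta}$.
   Context: All graphs are finite, simple and undirected; $P_m$ is the path on $m$ vertices. For $2\le\Delta\le n-1$, $B_{n,\Delta}$ is the tree of order $n$ obtained by attaching $\Delta-1$ pendant vertices to a terminal vertex of the path $P_{n-\Delta+1}$ (so $B_{n,2}=P_n$ and $B_{n,n-1}=S_n$, the star). For a connected graph $G$ with distance function $d_G$, the transmission of a vertex $u$ is $T_G(u)=\sum_{v\in V(G)}d_G(u,v)$, $T(G)$ is the diagonal matrix of transmissions and $D(G)=(d_G(u,v))_{u,v\in V(G)}$ the distance matrix. For $\alpha\in[0,1)$, $D_{\alpha}(G)=\alpha T(G)+(1-\alpha)D(G)$, and $\mu_{\alpha}(G)$ (the distance $\alpha$-spectral radius) is the largest eigenvalue of the symmetric matrix $D_{\alpha}(G)$. *)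

(* Defs.v *)
From mathcomp Require Import all_boot all_order all_algebra.
From mathcomp Require Import classical_sets reals.

Set Implicit Arguments.
Unset Strict Implicit.
Unset Printing Implicit Defensive.

Import Order.TTheory GRing.Theory Num.Theory.

Record sgraph := SGraph {
  vertex :> finType;
  adj : rel vertex;
  adj_sym : symmetric adj;
  adj_irr : irreflexive adj }.

Definition connected_graph (G : sgraph) : Prop :=
  forall x y : G, connect (@adj G) x y.

Definition degree (G : sgraph) (x : G) : nat := #|[set y | adj x y]|.

Definition max_degree (G : sgraph) : nat := \max_(x : G) degree x.

Definition isomorphic (G H : sgraph) : Prop :=
  exists f : G -> H, bijective f /\ forall x y, adj (f x) (f y) = adj x y.

Definition has_walk (G : sgraph) (x y : G) (k : nat) : bool :=
  [exists p : k.-tuple G, path (@adj G) x p && (last x p == y)].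

(* The least length of a walk from x to y.  A shortest walk repeats no vertex,
   so it is enough to search the lengths below #|G|; the value is #|G| when
   there is no walk. *)
Definition gdist (G : sgraph) (x y : G) : nat :=
  find (has_walk x y) (iota 0 #|G|).

Definition transmission (G : sgraph) (x : G) : nat := \sum_(y : G) gdist x y.

(* The tree B_{n,D} for 2 <= D <= n - 1: the path is 0, 1, ..., n - D, and the
   D - 1 remaining vertices n - D + 1, ..., n - 1 are attached to n - D. *)
Definition broom_arc (n D : nat) (i j : 'I_n) : bool :=
  (j == i.+1 :> nat) && (j <= n - D) || (i == n - D :> nat) && (n - D < j).

Definition broom_adj (n D : nat) : rel 'I_n :=
  [rel i j | broom_arc D i j || broom_arc D j i].

Lemma broom_adj_sym n D : symmetric (@broom_adj n D).
Proof. by move=> i j; exact: orbC. Qed.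

Lemma broom_adj_irr n D : irreflexive (@broom_adj n D).
Proof.
move=> i; rewrite /broom_adj /= /broom_arc.
rewrite ltn_eqF //= orbb; by case: eqP => //= ->; rewrite ltnn.
Qed.

Definition broom (n D : nat) : sgraph :=
  SGraph (@broom_adj_sym n D) (@broom_adj_irr n D).

Local Open Scope ring_scope.

Definition distance_mx (R : realType) (G : sgraph) : 'M[R]_#|G| :=
  \matrix_(i, j) (gdist (enum_val i : G) (enum_val j))%:R.

Definition transmission_mx (R : realType) (G : sgraph) : 'M[R]_#|G| :=
  diag_mx (\row_i (transmission (enum_val i : G))%:R).

Definition distance_alpha_mx (R : realType) (alpha : R) (G : sgraph) :
    'M[R]_#|G| :=
  alpha *: transmission_mx R G + (1 - alpha) *: distance_mx R G.

Definition is_largest_eigenvalue (R : realType) (m : nat) (A : 'M[R]_m)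
    (a : R) : Prop :=
  eigenvalue A a /\ forall b, eigenvalue A b -> b <= a.

(* xget picks an element of the set; a real symmetric matrix of positive order
   has exactly one largest eigenvalue, so the default 0 is then not used. *)
Definition largest_eigenvalue (R : realType) (m : nat) (A : 'M[R]_m) : R :=
  xget 0 [set a | is_largest_eigenvalue A a]%classic.

Definition distance_alpha_radius (R : realType) (alpha : R) (G : sgraph) : R :=
  largest_eigenvalue (distance_alpha_mx alpha G).

(* Main.v *)
Require Import Defs.

From mathcomp Require Import boolp classical_sets reals.
From mathcomp Require Import topology normedtype derive.
From mathcomp Require Import all_boot all_order all_algebra.
From mathcomp Require Import zify ring lra.

Import Order.TTheory GRing.Theory Num.Theory numFieldNormedType.Exports.

Set Implicit Arguments.
Unset Strict Implicit.
Unset Printing Implicit Defensive.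

(* With x a positive maximiser of the Rayleigh quotient of D_alpha(G), the form
   x D_alpha x^T is a sum of distances with the positive pair weights
   alpha x_s^2 + (1 - alpha) x_s x_t.  For fixed positive weights, a graph that
   maximises such a sum among the connected graphs on V(G) with some vertex of
   degree at least Delta is a broom: an edge outside a breadth-first tree could
   be deleted, and a branch at u could be regrafted at one of two neighbours of
   u, since the distances are convex along the path through u.  So the radius of
   the broom bounds that of G, and in case of equality G itself maximises the
   weighted sum. *)

(** * Distances as least walk lengths of a relation on a finite type *)

Section Dist.
Variable V : finType.
Implicit Types (e : rel V) (x y s t u : V) (A : {set V}).

Definition connected e := forall x y, connect e x y.

(** The body of [gdist] over a bare relation, so that the edges can vary on a fixed vertex type;
    [dist (@adj G)] and [gdist] are convertible. *)
Definition dist e x y : nat :=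
  find (fun k => [exists p : k.-tuple V, path e x p && (last x p == y)])
    (iota 0 #|V|).

Lemma dist_le_path e x p : path e x p -> dist e x (last x p) <= size p.
Proof.
move=> px; case: (ltnP (size p) #|V|) => [ltp|]; last first.
  by apply: leq_trans; rewrite -[leqRHS](size_iota 0) find_size.
rewrite leqNgt; apply/negP => /(before_find 0).
rewrite nth_iota // add0n => /existsP; apply.
by exists (in_tuple p); rewrite /= px eqxx.
Qed.

(** A walk without repeated vertices is shorter than [#|V|], so the search in [dist] succeeds and
    does not fall back on [#|V|]. *)
Lemma dist_path e x y : connect e x y ->
  exists2 p, path e x p & y = last x p /\ size p = dist e x y.
Proof.
move=> /connectP[q /shortenP[p px up _] ->].
have ltp : size p < #|V| by rewrite -[X in X <= _]/(size (x :: p)) -(card_uniqP up) max_card.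
have hp : has (fun k => [exists q : k.-tuple V, path e x q && (last x q == last x p)]) (iota 0 #|V|).
  apply/hasP; exists (size p); first by rewrite mem_iota.
  by apply/existsP; exists (in_tuple p); rewrite /= px eqxx.
have := nth_find 0 hp; rewrite nth_iota ?add0n; last by rewrite -[ltnRHS](size_iota 0) -has_find.
move=> /existsP[r /andP[pr /eqP lr]]; exists r => //; split=> //.
exact: size_tuple.
Qed.

Lemma distxx e x : dist e x x = 0.
Proof. by apply/eqP; rewrite -leqn0 (@dist_le_path e x [::]). Qed.

(* Every lower bound on a distance comes from a 1-Lipschitz potential. *)
Lemma dist_ge e (f : V -> nat) x y : connected e ->
  f x = 0 -> (forall s t, e s t -> f t <= (f s).+1) -> f y <= dist e x y.
Proof.
move=> ce f0 lip; have [p px [-> <-]] := dist_path (ce x y).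
suff: f (last x p) <= f x + size p by rewrite f0.
elim: p x px {f0} => [|z p IH] x /=; first by rewrite addn0.
by move=> /andP[/lip xz /IH]; lia.
Qed.

Lemma dist_eq0 e x y : connected e -> dist e x y = 0 -> x = y.
Proof. by move=> ce; have [[|z p] _ [-> <-]] := dist_path (ce x y). Qed.

Lemma dist_eq1 e x y : connected e -> dist e x y = 1 -> e x y.
Proof.
move=> ce; have [[|z [|? p]] + [-> <-]] := dist_path (ce x y) => //=.
by rewrite andbT.
Qed.

Lemma dist_edge e x s t : connected e -> e s t -> dist e x t <= (dist e x s).+1.
Proof.
move=> ce st; have [p px [sp <-]] := dist_path (ce x s).
have := @dist_le_path e x (rcons p t); rewrite last_rcons size_rcons; apply.
by rewrite rcons_path px -sp.
Qed.

Lemma dist_pred e x t : connected e -> t != x ->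
  exists2 s, e s t & dist e x t = (dist e x s).+1.
Proof.
move=> ce; have [p] := dist_path (ce x t); case/lastP: p => [|p s] /=.
  by move=> _ [-> _]; rewrite eqxx.
rewrite rcons_path last_rcons size_rcons => /andP[pp sl] [ts dp] _; subst t.
exists (last x p) => //.
by have := dist_edge x ce sl; have := dist_le_path pp; lia.
Qed.

Lemma dist_sym e : symmetric e -> connected e ->
  forall x y, dist e x y = dist e y x.
Proof.
move=> se ce; suff le_d x y : dist e x y <= dist e y x.
  by move=> x y; apply/eqP; rewrite eqn_leq !le_d.
apply: (@dist_ge e (dist e ^~ y)) => //; first exact: distxx.
move=> s t; rewrite se => ts; have [p ps [-> <-]] := dist_path (ce s y).
by apply: (@dist_le_path e t (s :: p)); rewrite /= ts.
Qed.

Lemma dist_triangle e x y z : connected e ->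
  dist e x z <= dist e x y + dist e y z.
Proof.
move=> ce; suff : dist e x z - dist e x y <= dist e y z by lia.
(* Truncated subtraction keeps this potential 1-Lipschitz, and it vanishes at [y]. *)
apply: (@dist_ge e (fun t => dist e x t - dist e x y)) => //; first lia.
by move=> s t /(dist_edge x ce); lia.
Qed.

Lemma dist_adj e x y : irreflexive e -> connected e -> e x y -> dist e x y = 1.
Proof.
move=> ie ce xy; have := dist_edge x ce xy; rewrite distxx.
case E: (dist e x y) => [|[|//]] // _.
by move: xy; rewrite (dist_eq0 ce E) ie.
Qed.

Lemma dist_mono e e' : connected e' -> subrel e' e ->
  forall x y, dist e x y <= dist e' x y.
Proof.
move=> ce' ee' x y; have [p px [-> <-]] := dist_path (ce' x y).
by apply: dist_le_path; apply: sub_path px.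
Qed.

Lemma connected_root e r : symmetric e ->
  (forall x, connect e r x) -> connected e.
Proof.
move=> se cr x y; apply: connect_trans (cr y).
by rewrite sym_connect_sym.
Qed.

End Dist.

Definition deg (V : finType) (e : rel V) (x : V) := #|[set y | e x y]|.

(** * Branches at a cut vertex and their regrafting *)

Section Regraft.
Variable V : finType.
Implicit Types (e : rel V) (x y z u s t : V) (A Y : {set V}).

(** For symmetric [e], this makes [A] a union of branches at [u], that is, of components left when
    [u] is removed. *)
Definition hangs_at e u A :=
  u \notin A /\ forall s t, s \in A -> e s t -> t \notin A -> t = u.

Lemma dist_through e u A s t : symmetric e -> connected e -> hangs_at e u A ->
  s \in A -> t \notin A -> dist e s u + dist e u t <= dist e s t.
Proof.
move=> se ce [uA hA] sA tA.
(* Inside [A] the distance from [s], outside it the length of the way through [u]; every edge across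
   the border ends at [u], where the two formulas agree. *)
pose f r := if r \in A then dist e s r else dist e s u + dist e u r.
suff: f t <= dist e s t by rewrite /f (negPf tA).
apply: dist_ge => //; first by rewrite /f sA distxx.
move=> a b ab; have ba : e b a by rewrite se.
rewrite /f; case: ifP => [bA|/negbT bA]; case: ifP => [aA|/negbT aA].
- exact: dist_edge.
- by rewrite (hA _ _ bA ba aA) distxx addn0 dist_edge // -(hA _ _ bA ba aA).
- by rewrite (hA _ _ aA ab bA) distxx addn0 dist_edge // -(hA _ _ aA ab bA).
- by rewrite -addnS leq_add2l dist_edge.
Qed.

(** [u] separates [t] from one of [y] and [z]. That one is a step farther from [t] than [u] is, and
    the other is at most a step nearer. *)
Lemma dist_midpoint e u y z Y t : symmetric e -> irreflexive e ->
  connected e -> hangs_at e u Y -> y \in Y -> z \notin Y -> e u y -> e u z ->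
  (dist e u t).*2 <= dist e y t + dist e z t.
Proof.
move=> se ie ce hY yY zY uy uz.
have far s : e u s -> dist e u t <= (dist e s t).+1.
  rewrite se => su; rewrite (dist_sym se ce u) (dist_sym se ce s).
  exact: dist_edge.
case: (boolP (t \in Y)) => tY.
  have := dist_through se ce hY tY zY; rewrite (dist_adj ie ce uz).
  by have := far y uy; rewrite !(dist_sym se ce t); lia.
have := dist_through se ce hY yY tY.
by rewrite (dist_sym se ce y u) (dist_adj ie ce uy); have := far z uz; lia.
Qed.

(** Each edge from [A] to [u] is redirected to [y]; edges inside [A] and edges inside its complement
    stay. *)
Definition regraft e u A y : rel V := fun s t =>
  if s \in A then (if t \in A then e s t else (t == y) && e s u)
  else if t \in A then (s == y) && e t u else e s t.

Lemma regraft_sym e u A y : symmetric e -> symmetric (regraft e u A y).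
Proof. by move=> se s t; rewrite /regraft; do 2!case: ifP => _. Qed.

Lemma regraft_irr e u A y : irreflexive e -> irreflexive (regraft e u A y).
Proof. by move=> ie s; rewrite /regraft; case: ifP => ->. Qed.

Section Regrafted.
Variables (e : rel V) (u : V) (A : {set V}).
Hypotheses (se : symmetric e) (ie : irreflexive e) (ce : connected e).
Hypothesis hA : hangs_at e u A.

Lemma regraft_connected y : y \notin A -> connected (regraft e u A y).
Proof.
case: hA => uA sepA yA; apply: (@connected_root _ _ u); first exact: regraft_sym.
(* A shortest path from [u] to a vertex outside [A] avoids [A], since it could leave [A] only
   through [u]; so it survives the regrafting. *)
have outA t : t \notin A -> connect (regraft e u A y) u t.
  elim: {t}_.+1 {-2}t (ltnSn (dist e u t)) => // n IH t; rewrite ltnS => lt_t tA.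
  have [->|tu] := eqVneq t u; first exact: connect0.
  have [s st ds] := dist_pred ce tu.
  have sA : s \notin A.
    by apply: contra tu => sA; apply/eqP/(sepA s).
  apply: connect_trans (IH s _ sA) (connect1 _); first by rewrite -ds.
  by rewrite /regraft (negPf sA) (negPf tA).
move=> t; case: (boolP (t \in A)) => [|/outA//].
elim: {t}_.+1 {-2}t (ltnSn (dist e u t)) => // n IH t; rewrite ltnS => lt_t tA.
have [tu|tu] := eqVneq t u; first by rewrite tu (negPf uA) in tA.
have [s st ds] := dist_pred ce tu.
case: (boolP (s \in A)) => sA.
  apply: connect_trans (IH s _ sA) (connect1 _); first by rewrite -ds.
  by rewrite /regraft sA tA.
have su : s = u by apply: (sepA t) => //; rewrite se.
apply: connect_trans (outA y yA) (connect1 _).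
by rewrite /regraft (negPf yA) tA eqxx se -su.
Qed.

(** Across the border, the old distances to [u] on the side of [A] and to [y] on the other side add
    up. The potentials are those of [dist_through] with the exit moved from [u] to [y]. *)
Lemma regraft_dist y s t : y \notin A ->
  (if s \in A then if t \in A then dist e s t else dist e s u + dist e y t
   else if t \in A then dist e s y + dist e u t else dist e s t)
  <= dist (regraft e u A y) s t.
Proof.
move=> yA; have ce' := regraft_connected yA.
have [sA|sA] := boolP (s \in A).
  pose f r := if r \in A then dist e s r else dist e s u + dist e y r.
  apply: (@dist_ge _ _ f) => //; first by rewrite /f sA distxx.
  move=> a b; rewrite /f /regraft; case: ifP => aA; case: ifP => bA.
  - exact: dist_edge.
  - by move=> /andP[/eqP-> au]; rewrite distxx addn0; exact: dist_edge.
  - move=> /andP[/eqP-> bu]; rewrite distxx addn0; apply: dist_edge => //.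
    by rewrite se.
  - by move=> ab; rewrite -addnS leq_add2l; exact: dist_edge.
pose f r := if r \in A then dist e s y + dist e u r else dist e s r.
apply: (@dist_ge _ _ f) => //; first by rewrite /f (negPf sA) distxx.
move=> a b; rewrite /f /regraft; case: ifP => aA; case: ifP => bA.
- by move=> ab; rewrite -addnS leq_add2l; exact: dist_edge.
- by move=> /andP[/eqP-> _]; rewrite leqW ?leq_addr.
- move=> /andP[/eqP-> bu]; rewrite -addn1 leq_add2l (dist_sym se) //.
  by rewrite (dist_adj ie ce bu).
- exact: dist_edge.
Qed.

Section TwoSides.
Variables (Y : {set V}) (y z : V).
Hypotheses (hY : hangs_at e u Y) (yY : y \in Y) (zY : z \notin Y).
Hypotheses (yA : y \notin A) (zA : z \notin A) (uy : e u y) (uz : e u z).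

(* The distances between a branch at u and the rest are convex along the path
   y, u, z, so regrafting the branch at y or at z gains on average. *)
Lemma regraft_convex s t :
  (dist e s t).*2 <= dist (regraft e u A y) s t + dist (regraft e u A z) s t.
Proof.
have := regraft_dist s t yA; have := regraft_dist s t zA.
have [sA|sA] := boolP (s \in A); have [tA|tA] := boolP (t \in A); try by lia.
  have := dist_midpoint t se ie ce hY yY zY uy uz.
  by have := dist_triangle s u t ce; lia.
have := dist_midpoint s se ie ce hY yY zY uy uz.
have := dist_triangle s u t ce; rewrite !(dist_sym se ce s); lia.
Qed.

(** Seen from [s], the vertex [u] now lies one step behind [y], respectively behind [z], so each
    regrafting adds at least 1. *)
Lemma regraft_strict s : s \in A -> (dist e s u).*2 <
  dist (regraft e u A y) s u + dist (regraft e u A z) s u.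
Proof.
clear hY yY zY; case: (hA) => uA _ sA.
have := regraft_dist s u yA; have := regraft_dist s u zA.
have -> := dist_sym se ce y u; have -> := dist_sym se ce z u.
by rewrite sA (negPf uA) (dist_adj ie ce uy) (dist_adj ie ce uz); lia.
Qed.

End TwoSides.

(** Outside [A] only [u] has neighbours in [A], so any other such vertex loses no edge. *)
Lemma regraft_degree w y : w \notin A -> w != u ->
  deg e w <= deg (regraft e u A y) w.
Proof.
case: hA => uA sepA wA wu; apply: subset_leq_card; apply/subsetP => t.
rewrite !inE /regraft (negPf wA) => wt.
case: ifP => // tA.
by move: wu; rewrite (sepA t w) ?eqxx // se.
Qed.

End Regrafted.
End Regraft.

(** * Maximisers of a weighted sum of distances *)

(** The maximum degree is only bounded below, so a modified graph needs one vertex of large degree;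
    degree exactly [D] at the chosen centre of a maximiser follows in [optimal_degree]. *)
Definition admissible (V : finType) (D : nat) (e : rel V) :=
  [/\ symmetric e, irreflexive e, connected e & exists x, D <= deg e x].

(** The sum runs over ordered pairs, as [wt] may be asymmetric. *)
Definition wiener (R : nzRingType) (V : finType) (wt : V -> V -> R) (e : rel V) : R :=
  (\sum_(p : V * V) wt p.1 p.2 * (dist e p.1 p.2)%:R)%R.

Section Optimal.
Variables (R : realDomainType) (V : finType) (wt : V -> V -> R) (D : nat).
Hypothesis wt_gt0 : forall s t, (0 < wt s t)%R.

Variable e : rel V.
Hypotheses (se : symmetric e) (ie : irreflexive e) (ce : connected e).
Hypothesis opt : forall e', admissible D e' -> (wiener wt e' <= wiener wt e)%R.

(** If no pair loses on average and one pair gains, the two indices add up to more than twice that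
    of [e], so [e1] or [e2] beats [e]. *)
Lemma optimal_no_gain e1 e2 s t : admissible D e1 -> admissible D e2 ->
  (forall a b, (dist e a b).*2 <= dist e1 a b + dist e2 a b) ->
  dist e1 s t + dist e2 s t <= (dist e s t).*2.
Proof.
move=> ad1 ad2 le12; rewrite leqNgt; apply/negP => lt12.
have := lerD (opt ad1) (opt ad2); apply/negP; rewrite -ltNge -!big_split /=.
rewrite (bigD1 (s, t)) //= [ltRHS](bigD1 (s, t)) //=.
apply: ltr_leD => [|]; last apply: ler_sum => p _.
  by rewrite -!mulrDr -!natrD ltr_pM2l // ltr_nat addnn.
by rewrite -!mulrDr -!natrD ler_pM2l // ler_nat addnn.
Qed.

(** By convexity, with a strict gain between [u] and a vertex of [A], the two regraftings cannot
    both be admissible. *)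
Lemma optimal_no_regraft u A Y y z : hangs_at e u A -> hangs_at e u Y ->
  A != set0 -> y \in Y -> z \notin Y -> y \notin A -> z \notin A ->
  e u y -> e u z ->
  (exists x, D <= deg (regraft e u A y) x) ->
  ~ (exists x, D <= deg (regraft e u A z) x).
Proof.
move=> hA hY /set0Pn[a aA] yY zY yA zA uy uz Dy Dz.
have ad w : w \notin A -> (exists x, D <= deg (regraft e u A w) x) ->
    admissible D (regraft e u A w).
  move=> wA Dw; split=> //; [exact: regraft_sym|exact: regraft_irr|].
  exact: regraft_connected.
have := regraft_strict se ie ce hA yA zA uy uz aA.
rewrite ltnNge => /negP; apply; apply: optimal_no_gain; try exact: ad.
exact: regraft_convex hY yY zY yA zA uy uz.
Qed.

(** * The breadth-first tree of a maximiser and its shape *)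

Hypothesis D_ge2 : 2 <= D.
Variable v : V.
Hypothesis Dv : D <= deg e v.
(* Any centre would do for D > 2; for D = 2 the broom is a path and v has to be
   one of the two vertices next to its ends. *)
Hypothesis far_v : forall x, D <= deg e x ->
  \sum_t dist e x t <= \sum_t dist e v t.

Definition level t := dist e v t.
(** The default [v] is reached only at the root, which thus is a fixed point of [parent]. *)
Definition parent t :=
  odflt v [pick s | e s t && (level t == (level s).+1)].

Lemma parent_root : parent v = v.
Proof. by rewrite /parent; case: pickP => //= s; rewrite {1}/level distxx andbF. Qed.

Lemma parentP t : t != v -> e (parent t) t /\ level t = (level (parent t)).+1.
Proof.
move=> tv; rewrite /parent; case: pickP => [s /andP[? /eqP]|] //=.
by have [s st ds] := dist_pred ce tv => /(_ s); rewrite st -ds eqxx.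
Qed.

Lemma level_eq0 t : level t = 0 -> t = v.
Proof. by move/(dist_eq0 ce). Qed.

Lemma level_root : level v = 0.
Proof. exact: distxx. Qed.

Lemma level_parent t : level (parent t) = (level t).-1.
Proof.
have [->|/parentP[_ ->//]] := eqVneq t v; by rewrite parent_root level_root.
Qed.

Lemma parent_nbr t : e v t -> parent t = v.
Proof.
move=> vt; apply: level_eq0.
by rewrite level_parent /level (dist_adj ie ce vt).
Qed.

Lemma parent_eq_root t : t != v -> parent t = v -> e v t.
Proof. by move=> tv <-; have [] := parentP tv. Qed.

(** Deleting an edge outside the breadth-first tree keeps the graph connected and keeps all edges at
    [v], which are tree edges. No distance drops and that of [s] and [t] grows, against
    [optimal_no_gain] with both graphs equal to [e1]. *)
Lemma optimal_tree s t : e s t -> parent t = s \/ parent s = t.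
Proof.
move=> st; case: (eqVneq (parent t) s) => [|pt]; first by left.
case: (eqVneq (parent s) t) => [|ps]; first by right.
exfalso.
pose e1 : rel V := fun a b =>
  e a b && ~~ ((a == s) && (b == t) || (a == t) && (b == s)).
have se1 : symmetric e1.
  by move=> a b; rewrite /e1 se orbC ![(b == _) && _]andbC.
have ie1 : irreflexive e1 by move=> a; rewrite /e1 ie.
have e1p a : a != v -> e1 (parent a) a.
  move=> /parentP[pa _]; rewrite /e1 pa /= negb_or !negb_and.
  apply/andP; split.
    by case: (eqVneq a t) => [->|]; rewrite ?pt ?orbT.
  by case: (eqVneq a s) => [->|]; rewrite ?ps ?orbT.
have ce1 : connected e1.
  apply: (@connected_root _ _ v) => // a.
  elim: {a}_.+1 {-2}a (ltnSn (level a)) => // n IH a lt_a.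
  have [->|av] := eqVneq a v; first exact: connect0.
  apply: connect_trans (IH (parent a) _) (connect1 (e1p _ av)).
  by have [_ la] := parentP av; rewrite la ltnS in lt_a.
have ad1 : admissible D e1.
  split=> //; exists v; apply: leq_trans Dv _; apply: subset_leq_card.
  apply/subsetP => a; rewrite !inE /e1 => va; rewrite va /=.
  apply/norP; split; apply/negP => /andP[/eqP vs /eqP at'].
    by move: pt; rewrite -at' -vs parent_nbr ?eqxx.
  by move: ps; rewrite -at' -vs parent_nbr ?eqxx.
have le1 : forall a b, dist e a b <= dist e1 a b.
  by apply: dist_mono => // a b /andP[].
have : dist e1 s t + dist e1 s t <= (dist e s t).*2.
  by apply: optimal_no_gain => // a b; rewrite -addnn leq_add.
rewrite (dist_adj ie ce st) addnn leq_double; case E: (dist e1 s t) => [|[|//]] // _.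
  by move: st; rewrite (dist_eq0 ce1 E) ie.
by move: (dist_eq1 ce1 E); rewrite /e1 !eqxx andbF.
Qed.

Definition descendants c := [set t | fconnect parent t c].

Lemma descendants_self c : c \in descendants c.
Proof. by rewrite inE connect0. Qed.

Lemma descendants_child c t : parent t \in descendants c -> t \in descendants c.
Proof. by rewrite !inE; apply: connect_trans; exact: fconnect1. Qed.

Lemma descendants_parent c t :
  t \in descendants c -> t != c -> parent t \in descendants c.
Proof.
rewrite !inE => /iter_findex; case: (findex _ _ _) => [|k]; first by move=> /= ->; rewrite eqxx.
by rewrite iterSr => <- _; exact: fconnect_iter.
Qed.

Lemma descendants_level c t :
  t \in descendants c -> t != c -> level c < level t.
Proof.
have lv k s : level (iter k parent s) = level s - k.
  by elim: k => [|k IH] /=; rewrite ?subn0 // level_parent IH -subnS.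
rewrite inE => /iter_findex; case: (findex _ _ _) => [|k]; first by move=> /= ->; rewrite eqxx.
(* The root has no ancestor but itself; any other [t] has positive level, so the truncated
   difference is strictly smaller. *)
case: (eqVneq t v) => [->|tv].
  move=> <-; rewrite (_ : iter _ _ _ = v) ?eqxx //.
  by elim: k => [|k IH]; rewrite iterSr parent_root.
by move=> <- _; rewrite lv; have [_ ->] := parentP tv; lia.
Qed.

(** All edges are tree edges, so only the edge from [c] to its parent leaves the subtree of [c]. *)
Lemma descendants_hang c : c != v -> hangs_at e (parent c) (descendants c).
Proof.
move=> cv; have [pc lc] := parentP cv; split.
  apply/negP => /descendants_level; rewrite lc.
  case: eqP => [pcc|_ /(_ isT)]; last by lia.
  by move: pc; rewrite pcc ie.
move=> s t sc st tc; have [ts|ts] := optimal_tree st.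
  by move: tc; rewrite descendants_child // ts.
by case: (eqVneq s c) => [<-|/(descendants_parent sc)]; rewrite ts // (negPf tc).
Qed.

Lemma level_notin c t : t != c -> level t <= level c -> t \notin descendants c.
Proof.
by move=> tc; rewrite leqNgt; apply: contra => /descendants_level; apply.
Qed.

(** Otherwise the branch of [c1] could be regrafted at [c2] or at [parent u]; neither lowers the
    degree of [v]. *)
Lemma optimal_one_child u c1 c2 : u != v -> c1 != v -> c2 != v ->
  parent c1 = u -> parent c2 = u -> c1 = c2.
Proof.
move=> uv c1v c2v p1 p2; apply/eqP/negPn/negP => c12.
have [e1 l1] := parentP c1v; have [e2 l2] := parentP c2v.
have [eu lu] := parentP uv.
have pc c : c != v -> parent c = u -> parent u != c.
  move=> /parentP[_ +] pcu; rewrite pcu => lc; apply/eqP => puc.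
  by rewrite puc in lu; lia.
have hA := descendants_hang c1v; have hY := descendants_hang c2v.
rewrite p1 p2 in e1 l1 e2 l2 hA hY.
have vA : v \notin descendants c1 by rewrite level_notin 1?eq_sym // level_root.
have zA : parent u \notin descendants c1 by rewrite level_notin ?pc //; lia.
have zY : parent u \notin descendants c2 by rewrite level_notin ?pc //; lia.
have yA : c2 \notin descendants c1 by rewrite level_notin 1?eq_sym // l1 l2.
apply: (optimal_no_regraft hA hY _ (descendants_self c2) zY yA zA) => //.
- by apply/set0Pn; exists c1; rewrite descendants_self.
- by rewrite se.
- by exists v; apply: leq_trans Dv _; apply: regraft_degree; rewrite // eq_sym.
- by exists v; apply: leq_trans Dv _; apply: regraft_degree; rewrite // eq_sym.
Qed.

Lemma nbr_neq t : e v t -> t != v.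
Proof. by apply: contraTneq => ->; rewrite ie. Qed.

Lemma nbr_hang c : e v c -> hangs_at e v (descendants c).
Proof. by move=> vc; rewrite -{1}(parent_nbr vc); apply/descendants_hang/nbr_neq. Qed.

Lemma nbr_notin c c' : e v c -> e v c' -> c != c' -> c \notin descendants c'.
Proof.
by move=> vc vc' cc'; rewrite level_notin // /level !(dist_adj ie ce).
Qed.

(** With more than [D] neighbours, hence at least three, one branch at [v] could move to either of
    two others, at the cost of a single neighbour of [v]. *)
Lemma optimal_degree : deg e v = D.
Proof.
apply/eqP; rewrite eqn_leq Dv andbT leqNgt; apply/negP => lt_D.
have /card_gt2P[c1 [c2 [c3 [[]]]]] : 2 < deg e v by apply: leq_ltn_trans lt_D.
rewrite !inE => v1 v2 v3 [n12 n23 n31].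
have deg_r y : D <= deg (regraft e v (descendants c1) y) v.
  have : D <= #|[set t | e v t] :\ c1|.
    by have := cardsD1 c1 [set t | e v t]; rewrite inE v1 -[#|[set t | e v t]|]/(deg e v); lia.
  move/leq_trans; apply; apply: subset_leq_card; apply/subsetP => t.
  rewrite !inE => /andP[tc vt]; have [vA _] := nbr_hang v1.
  by rewrite /regraft (negPf vA) (negPf (nbr_notin vt v1 tc)).
apply: (optimal_no_regraft (nbr_hang v1) (nbr_hang v2) _ (descendants_self c2)
  (nbr_notin v3 v2 _) (nbr_notin v2 v1 _) (nbr_notin v3 v1 _)) => //.
- by apply/set0Pn; exists c1; rewrite descendants_self.
- by rewrite eq_sym.
- by rewrite eq_sym.
- by exists v.
- by exists v.
Qed.

Lemma optimal_one_long_branch y z s t : e v y -> e v z -> s != v -> t != v ->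
  parent s = y -> parent t = z -> y = z.
Proof.
move=> vy vz sv tv ps pt; apply/eqP/negPn/negP => yz.
have hY := nbr_hang vy; have [vY _] := hY; have [vZ _] := nbr_hang vz.
have yY := descendants_self y; have zZ := descendants_self z.
have zy : z != y by rewrite eq_sym.
have zY := nbr_notin vz vy zy; have yZ := nbr_notin vy vz yz.
have two w r : e v w -> r != v -> parent r = w -> [set v; r] \subset [set x | e w x].
  move=> vw rv pr; apply/subsetP => x; rewrite !inE => /orP[] /eqP->.
    by rewrite se.
  by have [] := parentP rv; rewrite pr.
(* For [D = 2] the vertices [y] and [z] also have degree at least [D], so [far_v] bounds their total
   distances by that of [v]. But by [dist_midpoint] these add up to at least twice that of [v],
   strictly because of the term at [v]. *)
have [D2|D3] := leqP D 2.
  have le_v w r : e v w -> r != v -> parent r = w ->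
      \sum_x dist e w x <= \sum_x dist e v x.
    move=> vw rv pr; apply: far_v; apply: leq_trans D2 _.
    by have := subset_leq_card (two w r vw rv pr); rewrite cards2 eq_sym rv.
  have := leq_add (le_v y s vy sv ps) (le_v z t vz tv pt).
  apply/negP; rewrite -ltnNge -!big_split /=.
  rewrite (bigD1 v) //= [ltnRHS](bigD1 v) //= -addSn leq_add //.
    by rewrite distxx !(dist_sym se ce _ v) (dist_adj ie ce vy) (dist_adj ie ce vz).
  by apply: leq_sum => x _; rewrite addnn (dist_midpoint x se ie ce hY).
(* For [D > 2], all branches at [v] other than those of [y] and [z] are moved together to [y] or to
   [z]. *)
pose A := ~: (v |: (descendants y :|: descendants z)).
have inA x : (x \in A) = ~~ [|| x == v, x \in descendants y | x \in descendants z].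
  by rewrite in_setC !in_setU in_set1.
have hA : hangs_at e v A.
  split; first by rewrite inA eqxx.
  move=> a b; rewrite !inA !negb_or; case/and3P=> av aY aZ ab.
  rewrite -!negb_or negbK => /or3P[/eqP//|bY|bZ].
    have [_ sepY] := hY; have ba : e b a by rewrite se.
    by move: av; rewrite (sepY b a) ?eqxx.
  have [_ sepZ] := nbr_hang vz; have ba : e b a by rewrite se.
  by move: av; rewrite (sepZ b a) ?eqxx.
have yA : y \notin A by rewrite inA negbK yY orbT.
have zA : z \notin A by rewrite inA negbK zZ !orbT.
have NA x : x \in [set x | e v x] :\ y :\ z -> (x \in A) && e v x.
  move=> /setD1P[xz /setD1P[xy]]; rewrite inE => vx.
  by rewrite inA !negb_or vx nbr_neq // !nbr_notin.
have cardN : D - 2 <= #|[set x | e v x] :\ y :\ z|.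
  rewrite leq_subLR; apply: leq_trans Dv _.
  by rewrite /deg (cardsD1 y) inE vy (cardsD1 z (_ :\ y)) !inE zy vz.
have deg_r w r : w \notin A -> r \notin A -> e v w -> r != v -> parent r = w ->
    exists x, D <= deg (regraft e v A w) x.
  move=> wA rA vw rv pr; exists w.
  (* The new centre [w] is adjacent to [v], to its child [r] and to at least [D - 2] former
     neighbours of [v]. *)
  have sub : [set v; r] :|: ([set x | e v x] :\ y :\ z) \subset
      [set x | regraft e v A w w x].
    apply/subsetP => x; rewrite in_setU [x \in [set _ | _]]inE /regraft (negPf wA).
    move=> /orP[|/NA/andP[-> vx]]; last first.
      by rewrite eqxx se.
    move=> xvr; have := subsetP (two w r vw rv pr) x xvr.
    rewrite inE; case: ifP => // xA; move: xvr xA; rewrite !in_set2.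
    by move=> /orP[]/eqP->; rewrite ?(negPf rA) // (negPf (proj1 hA)).
  apply: leq_trans (subset_leq_card sub).
  rewrite cardsU cards2 eq_sym rv (_ : _ :&: _ = set0) ?cards0.
    by rewrite subn0 -leq_subLR.
  apply/setP => x; rewrite in_setI in_set0; apply/negP => /andP[+ /NA/andP[xA _]].
  by move: xA => /[swap]; rewrite in_set2 => /orP[]/eqP->; rewrite ?(negPf rA) // (negPf (proj1 hA)).
have sA : s \notin A.
  by rewrite inA negbK descendants_child ?orbT ?ps.
have tA : t \notin A.
  by rewrite inA negbK (@descendants_child z) ?orbT ?pt.
apply: (optimal_no_regraft hA hY _ yY zY yA zA vy vz).
- have /card_gt0P[x /NA/andP[xA _]] : 0 < #|[set x | e v x] :\ y :\ z|.
    by apply: leq_trans cardN; rewrite subn_gt0.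
  by apply/set0Pn; exists x.
- exact: (deg_r y s).
- exact: (deg_r z t).
Qed.

Lemma optimal_broom n : #|V| = n ->
  exists f : V -> 'I_n, bijective f /\
    forall x y, broom_adj D (f x) (f y) = e x y.
Proof.
move=> cardV; pose N := [set x | e v x].
have cardN : #|N| = D by exact: optimal_degree.
(* [c] is the neighbour of [v] that has children, or any neighbour if none has; the other
   neighbours, collected in [L], are leaves. *)
have [c cN long] : exists2 c, c \in N &
    forall x, x != v -> parent x \in N -> parent x = c.
  case: (pickP [pred x | (x != v) && (parent x \in N)]) => [x|no].
    rewrite !inE => /andP[xv vx]; exists (parent x); first by rewrite inE.
    move=> y yv; rewrite inE => vy.
    exact: (optimal_one_long_branch vy vx yv xv).
  have /card_gt0P[c cN] : 0 < #|N| by rewrite cardN; lia.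
  by exists c => // x xv xN; have := no x; rewrite /= xv xN.
pose L := N :\ c.
have cardL : #|L| = D.-1 by have := cardsD1 c N; rewrite cN cardN /L; lia.
have LN x : x \in L -> e v x by rewrite !inE => /andP[].
have vL : v \notin L by rewrite !inE ie andbF.
have leaf x : parent x \notin L.
  have [->|xv] := eqVneq x v; first by rewrite parent_root.
  apply/negP; rewrite !inE => /andP[pc vp]; move: pc.
  by rewrite (long x xv) ?inE ?eqxx.
(* Outside [L] the root has only the child [c] and every other vertex at most one child, so these
   vertices form a path from [v]. *)
have level_inj x y : x \notin L -> y \notin L -> level x = level y -> x = y.
  elim: {x}_.+1 {-2}x y (ltnSn (level x)) => // k IH x y lt_x xL yL lxy.
  have [xv|xv] := eqVneq x v.
    by apply/esym; rewrite xv; apply: level_eq0; rewrite -lxy xv level_root.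
  have [yv|yv] := eqVneq y v.
    by rewrite yv; apply: level_eq0; rewrite lxy yv level_root.
  have [ex lx] := parentP xv; have [ey ly] := parentP yv.
  have pxy : parent x = parent y by apply: IH; rewrite ?leaf //; lia.
  have [pv|pv] := eqVneq (parent x) v; last exact: (optimal_one_child pv).
  have inN z : z != v -> parent z = v -> z \notin L -> z = c.
    move=> zv /(parent_eq_root zv) vz; rewrite !inE vz andbT negbK.
    by move/eqP.
  by rewrite (inN x) // (inN y) // -pxy.
(* The proper ancestors of [x] lie outside [L], one on each lower level. *)
have level_le x : level x <= #|[set t | (t \notin L) && (level t < level x)]|.
  elim: {x}_.+1 {-2}x (ltnSn (level x)) => // k IH x lt_x.
  have [->|xv] := eqVneq x v; first by rewrite level_root.
  have [ex lx] := parentP xv.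
  rewrite (cardsD1 (parent x)) inE leaf lx leqnn /=.
  rewrite lx ltnS in lt_x; rewrite add1n ltnS; apply: leq_trans (IH _ lt_x) _.
  apply: subset_leq_card; apply/subsetP => t; rewrite !inE => /andP[-> lt_t].
  rewrite ltnS (ltnW lt_t) !andbT; apply/eqP => tp; by rewrite tp ltnn in lt_t.
have cardLc : #|~: L| = n - D + 1.
  have := cardsC L; have := max_card (mem N); rewrite cardN cardV cardL.
  by lia.
have level_lt x : x \notin L -> level x <= n - D.
  move=> xL; apply: leq_trans (level_le x) _.
  rewrite -ltnS -[(n - D).+1]addn1 -cardLc; apply: proper_card.
  apply/properP; split; first by apply/subsetP => t; rewrite !inE => /andP[].
  by exists x; rewrite !inE ?ltnn ?andbF //; move: xL; rewrite !inE.
have Dn : D < n.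
  rewrite -cardN -cardV -cardsT; apply: proper_card; apply/properP.
  by split; [exact: subsetT | exists v; rewrite ?inE ?ie].
(* The path is numbered backwards from [v], which gets [n - D], and the leaves take the numbers
   above. By [level_lt] the subtraction does not truncate. *)
pose g x := if x \in L then (n - D).+1 + index x (enum L) else n - D - level x.
have g_gt x : (n - D < g x) = (x \in L).
  rewrite /g; case: ifP => _; first by rewrite leq_addr.
  by rewrite ltnNge leq_subr.
have g_lt x : g x < n.
  rewrite /g; case: ifP => xL; last by lia.
  have : index x (enum L) < #|L| by rewrite cardE index_mem mem_enum.
  by rewrite cardL; lia.
exists (fun x => Ordinal (g_lt x)); split.
  apply: inj_card_bij; last by rewrite card_ord cardV.
  move=> x y [gxy]; have := g_gt x; rewrite gxy g_gt => yxL.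
  move: gxy; rewrite /g -yxL; case: ifP => yL; last first.
    move=> lxy; apply: level_inj; rewrite -?yxL ?yL //.
    have := level_lt x; have := level_lt y; rewrite -yxL yL; lia.
  move=> /addnI/(congr1 (nth v (enum L))).
  by rewrite !nth_index ?mem_enum // -yxL.
have gv x : (g x == n - D) = (x == v).
  apply/eqP/eqP => [gx|->]; last by rewrite /g (negPf vL) level_root subn0.
  have xL : x \notin L by rewrite -g_gt gx ltnn.
  by apply: level_eq0; have := level_lt x xL; move: gx; rewrite /g (negPf xL); lia.
(* Broom arcs lead from a path vertex to its parent, or from [v] to a leaf in [L]. *)
have arc x y : broom_arc D (Ordinal (g_lt x)) (Ordinal (g_lt y)) =
    [&& x != v, x \notin L & y == parent x] || (x == v) && (y \in L).
  rewrite /broom_arc /= gv g_gt [g y <= _]leqNgt g_gt; congr (_ || _).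
  apply/andP/and3P => [[/eqP gyx yL]|[xv xL /eqP->]]; last first.
    have [_ lx] := parentP xv; split; last exact: leaf.
    have := level_lt x xL.
    by rewrite /g (negPf xL) (negPf (leaf x)) lx; lia.
  have xL : x \notin L by rewrite -g_gt; move: yL; rewrite -g_gt gyx; lia.
  have xv : x != v.
    apply: contraNneq yL => /eqP; rewrite -gv => /eqP xv.
    by rewrite -g_gt gyx xv.
  split=> //; apply/eqP; apply: level_inj => //.
  have := level_lt x xL; have := level_lt y yL; rewrite level_parent.
  by move: gyx; rewrite /g (negPf xL) (negPf yL); lia.
have arcP x y : e x y -> parent x = y ->
    broom_arc D (Ordinal (g_lt x)) (Ordinal (g_lt y)) ||
    broom_arc D (Ordinal (g_lt y)) (Ordinal (g_lt x)).
  move=> xy px; have xv : x != v.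
    by apply: contraTneq xy => xv; rewrite -px xv parent_root ie.
  rewrite !arc xv px eqxx /=; case: (boolP (x \in L)) => //= xL.
  by rewrite -px (parent_nbr (LN x xL)) eqxx !orbT.
have edge x y : broom_arc D (Ordinal (g_lt x)) (Ordinal (g_lt y)) -> e x y.
  rewrite arc => /orP[/and3P[xv _ /eqP->]|/andP[/eqP-> /LN//]].
  by rewrite se; have [] := parentP xv.
move=> x y; apply/orP/idP => [[/edge//|/edge]|xy]; first by rewrite se.
have [py|px] := optimal_tree xy; apply/orP; last exact: arcP.
by rewrite orbC arcP // se.
Qed.

End Optimal.

Local Open Scope ring_scope.

(** * A positive maximiser of the Rayleigh quotient *)

Section RayleighMaximum.
Variables (R : realType) (m : nat) (A : 'M[R]_m).
Hypotheses (m_gt0 : (0 < m)%N) (A_sym : A^T = A).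
Hypotheses (A_ge0 : forall i j, 0 <= A i j).
Hypothesis (A_gt0 : forall i j, i != j -> 0 < A i j).

Definition qform (x : 'rV[R]_m) := \sum_i \sum_j A i j * (x 0 i * x 0 j).
Definition sqnorm (x : 'rV[R]_m) := \sum_i x 0 i ^+ 2.

Lemma continuous_sum (T : topologicalType) (I : Type) (r : seq I)
    (F : I -> T -> R) :
  (forall i, continuous (F i)) -> continuous (fun x => \sum_(i <- r) F i x).
Proof.
move=> cF; apply: continuous_big => //; exact: add_continuous.
Qed.

Lemma coord_mul_continuous i j : continuous (fun x : 'rV[R]_m => x 0 i * x 0 j).
Proof.
have c k : continuous (fun x : 'rV[R]_m => x 0 k) by exact: coord_continuous.
suff cM : continuous ((fun x : 'rV[R]_m => x 0 i) \* (fun x => x 0 j)) by exact: cM.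
by move=> x; apply: continuousM; exact: c.
Qed.

Lemma qform_continuous : continuous qform.
Proof.
apply: continuous_sum => i; apply: continuous_sum => j.
suff cM : continuous ((fun=> A i j) \* (fun x : 'rV[R]_m => x 0 i * x 0 j)).
  exact: cM.
move=> x; apply: continuousM; [exact: cst_continuous | exact: coord_mul_continuous].
Qed.

Lemma sqnorm_continuous : continuous sqnorm.
Proof. by apply: continuous_sum => i; exact: coord_mul_continuous. Qed.

Lemma sphere_compact : compact [set x | sqnorm x = 1]%classic.
Proof.
have cube : compact [set x : 'rV[R]_m | forall i, `[(-1 : R), 1]%classic (x ord0 i)]%classic.
  apply: (@rV_compact _ _ (fun=> `[(-1 : R), 1]%classic)) => _.
  exact: segment_compact.
apply: subclosed_compact cube _.
  apply: (@preimage_closed _ _ sqnorm [set 1]%classic) => [x _|].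
    exact: sqnorm_continuous.
  exact: closed_eq.
move=> x /= x1 i; rewrite in_itv /= -ler_norml -(ler_pXn2r (n := 2)) ?nnegrE //.
rewrite expr1n real_normK ?num_real // -x1 /sqnorm (bigD1 i) //= lerDl.
by apply: sumr_ge0 => j _; exact: sqr_ge0.
Qed.

Lemma sqnorm_ge0 x : 0 <= sqnorm x.
Proof. by apply: sumr_ge0 => i _; exact: sqr_ge0. Qed.

Lemma sqnorm_eq0 x : sqnorm x = 0 -> x = 0.
Proof.
move=> /eqP; rewrite psumr_eq0 => [/allP x0|i _]; last exact: sqr_ge0.
apply/rowP => i; rewrite mxE; apply/eqP.
by have := x0 i; rewrite mem_index_enum sqrf_eq0; apply.
Qed.

Lemma qformZ a x : qform (a *: x) = a ^+ 2 * qform x.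
Proof.
rewrite mulr_sumr; apply: eq_bigr => i _; rewrite mulr_sumr.
by apply: eq_bigr => j _; rewrite !mxE; ring.
Qed.

Lemma sqnormZ a x : sqnorm (a *: x) = a ^+ 2 * sqnorm x.
Proof. by rewrite mulr_sumr; apply: eq_bigr => i _; rewrite mxE exprMn. Qed.

(** A maximum on the compact unit sphere exists; homogeneity of degree 2 extends the bound to all
    vectors. *)
Lemma exists_qform_max :
  exists2 x, sqnorm x = 1 & forall y, qform y <= qform x * sqnorm y.
Proof.
pose i0 : 'I_m := Ordinal m_gt0.
have [||x /set_mem x1 xmax] := EVT_max_rV _ sphere_compact (f := qform).
- exists (delta_mx 0 i0) => /=; rewrite /sqnorm (bigD1 i0) //= big1 => [|i ii].
    by rewrite mxE !eqxx expr1n addr0.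
  by rewrite mxE eqxx (negPf ii) expr0n.
- exact/continuous_subspaceT/qform_continuous.
exists x => // y; have [y0|y0] := eqVneq (sqnorm y) 0.
  by rewrite (sqnorm_eq0 y0) -[0](scale0r 0) qformZ sqnormZ expr0n !mul0r mulr0.
have gt0 : 0 < sqnorm y by rewrite lt_def y0 sqnorm_ge0.
have := xmax ((Num.sqrt (sqnorm y))^-1 *: y).
rewrite qformZ exprVn sqr_sqrtr ?sqnorm_ge0 // mulrC ler_pdivrMr //; apply.
by apply/mem_set; rewrite /= sqnormZ exprVn sqr_sqrtr ?sqnorm_ge0 // mulVf.
Qed.

Definition bform (x y : 'rV[R]_m) := \sum_i (\sum_j x 0 j * A j i) * y 0 i.

Lemma qformD x y t :
  qform (x + t *: y) = qform x + t * 2 * bform x y + t ^+ 2 * qform y.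
Proof.
have -> : t * 2 * bform x y =
    \sum_i \sum_j A i j * (t * (x 0 i * y 0 j)) +
    \sum_i \sum_j A i j * (t * (x 0 j * y 0 i)).
  rewrite exchange_big /= -big_split /= mulr_sumr; apply: eq_bigr => i _.
  rewrite -big_split /= mulr_suml mulr_sumr; apply: eq_bigr => j _.
  have -> : A i j = A j i by rewrite -[in LHS]A_sym mxE.
  by ring.
rewrite /qform mulr_sumr -!big_split /=; apply: eq_bigr => i _.
rewrite mulr_sumr -!big_split /=; apply: eq_bigr => j _.
by rewrite !mxE; ring.
Qed.

Lemma sqnormD x y t : sqnorm (x + t *: y) =
  sqnorm x + t * 2 * (\sum_i x 0 i * y 0 i) + t ^+ 2 * sqnorm y.
Proof.
rewrite /sqnorm !mulr_sumr -!big_split /=; apply: eq_bigr => i _.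
by rewrite !mxE; ring.
Qed.

Lemma quadratic_ge0_linear (b c : R) :
  (forall t, 0 <= t * b + t ^+ 2 * c) -> b = 0.
Proof.
move=> H; apply/eqP/negPn/negP => b0.
have c1 : 0 < `|c| + 1 by rewrite ltr_wpDl.
(* The quadratic is negative at this [t] when [b] is nonzero, since [c] is below the positive number
   [|c| + 1]. *)
have := H (- b / (`|c| + 1)).
have -> : - b / (`|c| + 1) * b + (- b / (`|c| + 1)) ^+ 2 * c =
  (b / (`|c| + 1)) ^+ 2 * (c - (`|c| + 1)) by field; rewrite gt_eqF.
apply/negP; rewrite -ltNge pmulr_rlt0.
  by have := ler_norm c; lra.
by rewrite exprn_even_gt0 //= mulf_neq0 // invr_eq0 gt_eqF.
Qed.

(** First variation: along each coordinate direction the defect in the maximum inequality is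
    nonnegative and vanishes at [t = 0], so its linear term is zero. *)
Lemma qform_max_eigenvector x : sqnorm x = 1 ->
  (forall y, qform y <= qform x * sqnorm y) -> x *m A = qform x *: x.
Proof.
move=> x1 xmax; apply/rowP => k; rewrite !mxE.
pose y : 'rV[R]_m := delta_mx 0 k.
have sumk (F : 'I_m -> R) : \sum_i F i * y 0 i = F k.
  rewrite (bigD1 k) //= mxE !eqxx mulr1 big1 ?addr0 // => i ik.
  by rewrite mxE eqxx (negPf ik) mulr0.
have := @quadratic_ge0_linear
  (2 * (qform x * x 0 k - \sum_j x 0 j * A j k))
  (qform x * sqnorm y - qform y).
move=> /(_ _)/eqP; rewrite mulf_eq0 pnatr_eq0 /= subr_eq0 => H.
apply/eqP; rewrite eq_sym; apply: H => t.
have := xmax (x + t *: y); rewrite qformD sqnormD x1 /bform !sumk.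
by rewrite -subr_ge0; congr (0 <= _); ring.
Qed.

Lemma perron : exists2 x : 'rV[R]_m, (forall i, 0 < x 0 i) &
  exists lam, [/\ x *m A = lam *: x, qform x = lam * sqnorm x &
    forall y, qform y <= lam * sqnorm y].
Proof.
have [z z1 zmax] := exists_qform_max.
(* As the entries of [A] are nonnegative, absolute values keep a maximiser. A zero coordinate of the
   eigenvector [x] would then force all others to vanish, the off-diagonal entries being
   positive. *)
pose x : 'rV[R]_m := \row_i `|z 0 i|.
have x1 : sqnorm x = 1.
  by rewrite -z1; apply: eq_bigr => i _; rewrite mxE real_normK ?num_real.
have qzx : qform z <= qform x.
  apply: ler_sum => i _; apply: ler_sum => j _.
  by rewrite ler_wpM2l // !mxE -normrM ler_norm.
have xmax y : qform y <= qform x * sqnorm y.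
  by apply: le_trans (zmax y) _; rewrite ler_wpM2r ?sqnorm_ge0.
have xA := qform_max_eigenvector x1 xmax.
exists x; last by exists (qform x); rewrite x1 mulr1.
have x_ge0 i : 0 <= x 0 i by rewrite mxE.
move=> i; rewrite lt_def x_ge0 andbT; apply/eqP => xi0.
suff x0 : x = 0.
  move: x1; rewrite x0 /sqnorm big1 => [/esym/eqP|j _]; first by rewrite oner_eq0.
  by rewrite mxE expr0n.
have : (x *m A) 0 i = 0 by rewrite xA mxE xi0 mulr0.
rewrite mxE => /eqP; rewrite psumr_eq0 => [/allP h|j _]; last exact: mulr_ge0.
apply/rowP => j; rewrite [RHS]mxE; have [->//|ji] := eqVneq j i.
have /(_ (mem_index_enum j)) := h j.
by rewrite /= mulf_eq0 [A j i == 0]gt_eqF ?A_gt0 // orbF => /eqP.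
Qed.

End RayleighMaximum.

(** * Identification of the largest eigenvalue *)

Section LargestEigenvalue.
Variables (R : realType) (m : nat) (A : 'M[R]_m).

Lemma qform_eigenvector x a : x *m A = a *: x -> qform A x = a * sqnorm x.
Proof.
move=> xA; rewrite /qform exchange_big mulr_sumr; apply: eq_bigr => i _.
have := congr1 (fun y : 'rV_m => y 0 i) xA; rewrite !mxE => xAi.
rewrite expr2 mulrA -xAi mulr_suml; apply: eq_bigr => j _.
by rewrite mulrA [A j i * _]mulrC.
Qed.

(** The bound on the form, taken at eigenvectors, makes [lam] largest; two largest eigenvalues bound
    each other, so [xget] can only return [lam]. *)
Lemma largest_eigenvalueE (x : 'rV[R]_m) lam : x != 0 -> x *m A = lam *: x ->
  (forall y, qform A y <= lam * sqnorm y) -> largest_eigenvalue A = lam.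
Proof.
move=> x0 xA lamP.
have lamL : is_largest_eigenvalue A lam.
  split=> [|b /eigenvalueP[y yA y0]]; first by apply/eigenvalueP; exists x.
  have := lamP y; rewrite (qform_eigenvector yA) ler_pM2r //.
  rewrite lt_def sqnorm_ge0 andbT; apply: contra y0 => /eqP/sqnorm_eq0->.
  exact: eqxx.
have [e le] : is_largest_eigenvalue A (largest_eigenvalue A).
  exact: (@xgetI _ 0 [set a | is_largest_eigenvalue A a]%classic lam).
by apply/eqP; rewrite eq_le (lamL.2 _ e) le //; case: lamL.
Qed.

End LargestEigenvalue.

(** * The distance alpha-spectral radius as a maximum of weighted distance sums *)

Section Radius.
Variables (R : realType) (alpha : R).
Hypothesis alpha01 : 0 <= alpha < 1.

(** The coefficient of the distance from [s] to [t] in the quadratic form, once the transmission of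
    [s] is expanded into distances. *)
Definition pair_weight (T : Type) (x : T -> R) (s t : T) :=
  alpha * x s ^+ 2 + (1 - alpha) * (x s * x t).

Lemma pair_weight_gt0 (T : Type) (x : T -> R) s t :
  (forall r, 0 < x r) -> 0 < pair_weight x s t.
Proof.
move=> x0; case/andP: alpha01 => a0 a1; rewrite /pair_weight.
apply: ltr_wpDl; first by apply: mulr_ge0 => //; exact: sqr_ge0.
by apply: mulr_gt0; [rewrite subr_gt0 | exact: mulr_gt0].
Qed.

Definition energy (G : sgraph) (x : G -> R) := wiener (pair_weight x) (@adj G).

Lemma sum_enum_rank (T : finType) (F : 'I_#|T| -> R) :
  \sum_i F i = \sum_(s : T) F (enum_rank s).
Proof. by rewrite (reindex (@enum_rank T)) //; apply/onW_bij/enum_rank_bij. Qed.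

Lemma qform_energy (G : sgraph) (x : 'rV[R]_#|G|) :
  qform (distance_alpha_mx alpha G) x = energy (fun s => x 0 (enum_rank s)).
Proof.
rewrite /energy /wiener -(pair_big xpredT xpredT
  (fun s t => pair_weight (fun s => x 0 (enum_rank s)) s t * (dist (@adj G) s t)%:R)).
rewrite /qform sum_enum_rank; apply: eq_bigr => s _; rewrite sum_enum_rank.
pose X s := x 0 (enum_rank s); rewrite -!/(X _).
transitivity (\sum_t ((alpha * (transmission s)%:R *+ (s == t)) * (X s * X t) +
   (1 - alpha) * (gdist s t)%:R * (X s * X t))).
  apply: eq_bigr => t _; rewrite -mulrDl !mxE !enum_rankK -mulrnAr.
  by rewrite (inj_eq enum_rank_inj).
rewrite big_split /= (bigD1 s) //= eqxx mulr1n big1 ?addr0 => [|t ts]; last first.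
  by rewrite eq_sym (negPf ts) mulr0n mul0r.
rewrite /transmission natr_sum mulr_sumr mulr_suml -big_split /=.
by apply: eq_bigr => t _; rewrite /pair_weight -!/(X _); ring.
Qed.

(** The Rayleigh characterisation on functions of the vertices, free of matrix indices. Distinct
    vertices have positive distance and [alpha < 1], so [perron] applies. *)
Lemma radius_spec (G : sgraph) : connected_graph G -> (0 < #|G|)%N ->
  (forall x : G -> R,
    energy x <= distance_alpha_radius alpha G * \sum_s x s ^+ 2) /\
  exists2 x : G -> R, (forall s, 0 < x s) &
    energy x = distance_alpha_radius alpha G * \sum_s x s ^+ 2.
Proof.
move=> cG G0; set A := distance_alpha_mx alpha G; case/andP: alpha01 => a0 a1.
have dsym : forall s t, gdist s t = gdist t s :> nat := dist_sym (@adj_sym G) cG.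
have A_sym : A^T = A.
  apply/matrixP => i j; rewrite !mxE eq_sym dsym; case: eqP => [->|] //.
have A_ge0 i j : 0 <= A i j.
  by rewrite !mxE addr_ge0 ?mulr_ge0 ?mulrn_wge0 ?subr_ge0 // ltW.
have A_gt0 i j : i != j -> 0 < A i j.
  move=> ij; rewrite !mxE (negPf ij) mulr0n mulr0 add0r mulr_gt0 ?subr_gt0 //.
  rewrite ltr0n lt0n; apply: contra ij => /eqP/(dist_eq0 cG)/enum_val_inj->.
  exact: eqxx.
have [x x_gt0 [lam [xA qx lamP]]] := perron G0 A_sym A_ge0 A_gt0.
have rho : distance_alpha_radius alpha G = lam.
  apply: largest_eigenvalueE xA lamP; apply/eqP => x0.
  by have := x_gt0 (Ordinal G0); rewrite x0 mxE ltxx.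
rewrite rho; split=> [y|].
  have := lamP (\row_i y (enum_val i)); rewrite qform_energy /sqnorm sum_enum_rank.
  under eq_bigr do rewrite mxE enum_rankK.
  congr (_ <= _); rewrite /energy /wiener; apply: eq_bigr => p _.
  by rewrite /pair_weight !mxE !enum_rankK.
exists (fun s => x 0 (enum_rank s)) => //.
by rewrite -qform_energy qx /sqnorm sum_enum_rank.
Qed.

End Radius.

(** * Invariance of the radius under isomorphism *)

Lemma dist_hom (V W : finType) (e : rel V) (e' : rel W) (f : V -> W) :
  connected e -> (forall s t, e s t -> e' (f s) (f t)) ->
  forall s t, (dist e' (f s) (f t) <= dist e s t)%N.
Proof.
move=> ce fe s t; have [p ps [-> <-]] := dist_path (ce s t).
rewrite -last_map -(size_map f); apply: dist_le_path.
by apply: homo_path ps => a b; exact: fe.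
Qed.

Lemma isomorphic_sym (G H : sgraph) : isomorphic G H -> isomorphic H G.
Proof.
move=> [f [[g fK gK] fe]]; exists g; split; first by exists f.
by move=> x y; rewrite -fe !gK.
Qed.

Lemma isomorphic_connected (G H : sgraph) :
  isomorphic G H -> connected_graph G -> connected_graph H.
Proof.
move=> [f [[g fK gK] fe]] cG x y; have /connectP[p px gy] := cG (g x) (g y).
apply/connectP; exists (map f p); last by rewrite -[y]gK gy -(last_map f) gK.
by rewrite -[x]gK; apply: homo_path px => a b; rewrite fe.
Qed.

Lemma radius_isomorphic_le (R : realType) (alpha : R) (G H : sgraph) :
  0 <= alpha < 1 -> connected_graph G -> (0 < #|G|)%N -> isomorphic G H ->
  distance_alpha_radius alpha G <= distance_alpha_radius alpha H.
Proof.
move=> a01 cG G0 GH; have cH := isomorphic_connected GH cG.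
have [f [bf fe]] := GH; have [g fK gK] := bf.
have H0 : (0 < #|H|)%N by rewrite -(bij_eq_card bf).
have [_ [x x0 Ex]] := radius_spec a01 cG G0.
have [/(_ (x \o g)) + _] := radius_spec a01 cH H0.
have distE s t : dist (@adj H) (f s) (f t) = dist (@adj G) s t.
  apply/eqP; rewrite eqn_leq dist_hom ?fe //= => [|s' t']; last by rewrite fe.
  rewrite -{1}[s]fK -{1}[t]fK dist_hom //.
  by move=> a b; rewrite -[a in adj a _]gK -[b in adj _ b]gK fe.
have -> : energy alpha (x \o g) = energy alpha x.
  rewrite /energy /wiener (reindex (fun p => (f p.1, f p.2))) /=; last first.
    exists (fun p => (g p.1, g p.2)) => -[a b] _ /=; by rewrite ?fK ?gK.
  by apply: eq_bigr => p _; rewrite distE /pair_weight /= !fK.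
have -> : \sum_s (x \o g) s ^+ 2 = \sum_s x s ^+ 2.
  rewrite (reindex f) /=; last exact: onW_bij.
  by apply: eq_bigr => s _; rewrite fK.
rewrite Ex ler_pM2r // (bigD1 (enum_val (Ordinal G0))) //=.
by rewrite ltr_wpDr ?exprn_gt0 // sumr_ge0 // => s _; exact: sqr_ge0.
Qed.

Lemma radius_isomorphic (R : realType) (alpha : R) (G H : sgraph) :
  0 <= alpha < 1 -> connected_graph G -> (0 < #|G|)%N -> isomorphic G H ->
  distance_alpha_radius alpha G = distance_alpha_radius alpha H.
Proof.
move=> a01 cG G0 GH; apply/eqP; rewrite eq_le radius_isomorphic_le //=.
have [f [bf _]] := GH.
apply: radius_isomorphic_le => //; last exact: isomorphic_sym.
  exact: isomorphic_connected GH cG.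
by rewrite -(bij_eq_card bf).
Qed.

(** * Existence of a maximiser and comparison with the broom *)

Lemma wiener_maximizer (R : realDomainType) (V : finType) (wt : V -> V -> R)
    (D : nat) (e0 : rel V) : admissible D e0 ->
  exists2 e, admissible D e &
    forall e', admissible D e' -> wiener wt e' <= wiener wt e.
Proof.
(* Coded as finite functions, the relations form a finite type, on which a maximum is attained. *)
move=> ad0; pose r (F : {ffun V * V -> bool}) : rel V := fun s t => F (s, t).
have rK e : r [ffun p => e p.1 p.2] = e.
  by apply/funext => s; apply/funext => t; rewrite /r ffunE.
pose P F := `[< admissible D (r F) >].
have P0 : P [ffun p => e0 p.1 p.2] by apply/asboolP; rewrite rK.
case: (arg_maxP (fun F => wiener wt (r F)) P0) => F /asboolP adF maxF.
exists (r F) => // e' ad'; rewrite -(rK e').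
by apply: maxF; apply/asboolP; rewrite rK.
Qed.

Lemma maximizer_broom (R : realDomainType) (V : finType) (wt : V -> V -> R)
    (D : nat) (e : rel V) :
  (forall s t, 0 < wt s t) -> (2 <= D)%N -> admissible D e ->
  (forall e', admissible D e' -> wiener wt e' <= wiener wt e) ->
  exists f : V -> 'I_#|V|, bijective f /\
    forall x y, broom_adj D (f x) (f y) = e x y.
Proof.
move=> wt0 D2 [se ie ce [x0 Dx0]] opt.
(* The centre is a vertex of greatest total distance among those of degree at least [D]. *)
case: (@arg_maxnP _ x0 (fun x => D <= deg e x)%N
  (fun x => \sum_t dist e x t)%N Dx0) => v Dv far.
exact: (optimal_broom wt0 se ie ce opt D2 Dv far).
Qed.

Theorem theorem6p1 (R : realType) (alpha : R) (n Delta : nat) (G : sgraph) :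
  0 <= alpha < 1 ->
  connected_graph G ->
  #|G| = n ->
  (5 <= n)%N ->
  max_degree G = Delta ->
  (2 <= Delta <= n - 1)%N ->
  distance_alpha_radius alpha G <= distance_alpha_radius alpha (broom n Delta)
  /\ (distance_alpha_radius alpha G = distance_alpha_radius alpha (broom n Delta)
      <-> isomorphic G (broom n Delta)).
Proof.
move=> a01 cG cardG n5 degG /andP[D2 _]; subst n.
have G0 : (0 < #|G|)%N by apply: leq_trans n5.
have adG : admissible Delta (@adj G).
  split=> //; [exact: adj_sym|exact: adj_irr|].
  have [x xmax] := bigop.eq_bigmax (@degree G) G0.
  by exists x; rewrite -degG /max_degree xmax.
have [_ [x x_gt0 Ex]] := radius_spec a01 cG G0.
have wt0 s t : 0 < pair_weight alpha x s t by exact: pair_weight_gt0.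
have [e ade emax] := wiener_maximizer (pair_weight alpha x) adG.
have [se ie ce _] := ade; pose Ge := SGraph se ie.
have GeB : isomorphic Ge (broom #|G| Delta) := maximizer_broom wt0 D2 ade emax.
have rhoB := radius_isomorphic a01 (ce : connected_graph Ge) G0 GeB.
(* For the maximiser [Ge] the Perron vector [x] of [G] serves only as a test vector. *)
have [/(_ x) le_e _] := radius_spec a01 (ce : connected_graph Ge) G0.
have x2 : 0 < \sum_s x s ^+ 2.
  rewrite (bigD1 (enum_val (Ordinal G0))) //= ltr_wpDr ?exprn_gt0 //.
  by rewrite sumr_ge0 // => s _; exact: sqr_ge0.
split.
  by rewrite -rhoB -(ler_pM2r x2) -Ex; apply: le_trans le_e; exact: emax.
split=> [eqB|]; last exact: radius_isomorphic.
(* Equal radii bound the energy of [Ge] at [x] by that of [G], so [G] is itself a maximiser. *)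
apply: (maximizer_broom wt0 D2 adG) => e' ad'; apply: le_trans (emax _ ad') _.
by apply: le_trans le_e _; rewrite rhoB -eqB -Ex.
Qed.
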